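(* Let $f(x)=x^3+c_2x^2+c_1x+c_0\in\mathbb{Z}[x]$ have non-zero discriminant, let $g(x)\in\mathbb{Z}[x]$ have no common root with $f$ in $\overline{\mathbb{Q}}$, and let $C$ be the curve $y^2=f(x)g(x)$. Set $N=R(0,0)$, where $R(u,v)=\mathrm{res}_x(u^2-f(x),\,v^2-g(x))$. Let $$\Sigma_N=\{d\in\mathbb{Z}: d \text{ squarefree},\ d\mid N\}$$ and $$\mathcal{M}_N(f)=\Big\{\frac{a}{d}: a\in\mathbb{Z},\ d\in\Sigma_N,\ \text{there is } b\in\mathbb{Z} \text{ with } d^2\mid b \text{ and } b^2=a^3+c_2da^2+c_1d^2a+c_0d^3\Big\}.$$ Then $$C(\mathbb{Z})=\{(s,t)\in\mathbb{Z}^2: s\in\mathcal{M}_N(f),\ t^2=f(s)g(s)\}.$$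
   Context: $C(\mathbb{Z})$ denotes the set of integer points $(x,y)\in\mathbb{Z}^2$ of $C$. $\mathrm{res}_x$ denotes the resultant with respect to $x$ (of polynomials in $x$ with coefficients in $\mathbb{Z}[u,v]$). Squarefree integers may be negative; $\pm1$ are squarefree. *)

(* Defs.v *)
From HB Require Import structures.
From mathcomp Require Import all_boot all_order all_algebra all_field.
From mathcomp Require Import boolp classical_sets.
From mathcomp Require Import mpoly.

Set Implicit Arguments.
Unset Strict Implicit.
Unset Printing Implicit Defensive.

Import GRing.Theory Num.Theory.

Local Open Scope ring_scope.
Local Open Scope classical_set_scope.

(* disc p = (-1)^(n(n-1)/2) res(p, p') / lc(p), with n = deg p; for n > 0 the
   division is exact. *)
Definition discriminant (p : {poly int}) : int :=
  (((-1) ^+ 'C((size p).-1, 2) * resultant p p^`()) %/ lead_coef p)%Z.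

Definition no_common_root (p q : {poly int}) : Prop :=
  forall z : algC, ~ (root (map_poly intr p) z /\ root (map_poly intr q) z).

Definition cubic (c2 c1 c0 : int) : {poly int} :=
  'X^3 + c2 *: 'X^2 + c1 *: 'X + c0%:P.

(* The units of int are 1 and -1. Negative integers are allowed, 1 and -1 are
   squarefree, and 0 is not. *)
Definition squarefree (d : int) : Prop :=
  forall m : int, (m ^+ 2 %| d)%Z -> m \is a GRing.unit.

(* Integer points of the affine curve y^2 = h(x). *)
Definition integer_points (h : {poly int}) : set (int * int) :=
  [set P | P.2 ^+ 2 = h.[P.1]].

(* In Z[u,v] = {mpoly int[2]}, u and v are the variables of index 0 and 1;
   x is the univariate variable of {poly {mpoly int[2]}}. *)
Definition uvar : {mpoly int[2]} := 'X_(0 : 'I_2).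
Definition vvar : {mpoly int[2]} := 'X_(1 : 'I_2).

Definition toZuv (p : {poly int}) : {poly {mpoly int[2]}} :=
  map_poly (@mpolyC 2 int) p.

Definition Ruv (f g : {poly int}) : {mpoly int[2]} :=
  resultant ((uvar ^+ 2)%:P - toZuv f) ((vvar ^+ 2)%:P - toZuv g).

Definition R00 (f g : {poly int}) : int := (Ruv f g).@[fun=> 0].

Definition Sigma (N : int) : set int := [set d | squarefree d /\ (d %| N)%Z].

Definition Mset (N c2 c1 c0 : int) : set rat :=
  [set q | exists a d : int,
     [/\ Sigma N d,
         exists b : int, (d ^+ 2 %| b)%Z /\
           b ^+ 2 = a ^+ 3 + c2 * d * a ^+ 2 + c1 * d ^+ 2 * a + c0 * d ^+ 3
       & q = a%:~R / d%:~R]].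

(* Main.v *)
Require Import Defs.
From mathcomp Require Import all_boot all_order all_algebra all_field.
From mathcomp Require Import boolp classical_sets.
From mathcomp Require Import mpoly.
From mathcomp Require Import ring.

(** If $f(s) \neq 0$, write $f(s) = d y^2$ with $d$ squarefree. Since
    $f(s) g(s)$ is a square, so is $d\,g(s)$, and as $d$ is squarefree it
    divides $g(s)$. The resultant of $u^2 - f$ and $v^2 - g$ lies in the ideal
    they generate, so putting $u = v = 0$ and $x = s$ shows that $d$ divides
    $N$; then $a = ds$ and $b = d^2 y$ witness $s \in \mathcal{M}_N(f)$. If
    $f(s) = 0$, then $d = 1$, $a = s$ and $b = 0$ do. *)

Set Implicit Arguments.
Unset Strict Implicit.
Unset Printing Implicit Defensive.

Import Order.TTheory GRing.Theory Num.Theory.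

Local Open Scope ring_scope.
Local Open Scope classical_set_scope.

Lemma squarefree1 : squarefree 1.
Proof.
move=> m /dvdzP [q /esym qm].
by apply/unitrPr; exists (q * m); rewrite mulrCA -expr2.
Qed.

Lemma unitzE (m : int) : (m \is a GRing.unit) = (`|m| == 1)%N.
Proof. by rewrite [LHS]/((m == 1) || (m == -1)) -eqz_nat abszE eqr_norml andbT. Qed.

(** Strong induction on $|n|$: if $m^2 \mid n$ with $m$ not a unit, apply the induction hypothesis
    to the cofactor $q = n/m^2$ and absorb $m$ into [y]. The sign of $n$ stays in [d]. *)
Lemma squarefree_part (n : int) : n != 0 ->
  exists d y : int, squarefree d /\ n = d * y ^+ 2.
Proof.
have [k le_nk] := ubnP `|n|%N; elim: k n le_nk => // k IHk n lt_nk n0.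
have [sqf|/existsNP [m /not_implyP [/dvdzP [q Dn] /negP Um]]] :=
  pselect (squarefree n).
  by exists n, 1; rewrite expr1n mulr1.
move: n0; rewrite Dn mulf_eq0 negb_or expf_eq0 /= => /andP [q0 m0].
(* As $m$ is neither zero nor a unit, $|m| > 1$, so $|q| < |q| m^2 = |n|$. *)
have lt_qk : (`|q| < k)%N.
  move: lt_nk; rewrite ltnS; apply: leq_trans.
  rewrite Dn abszM abszX -[X in (X < _)%N]muln1 ltn_pmul2l ?absz_gt0 //.
  rewrite -[1%N](exp1n 2) ltn_exp2r // ltn_neqAle absz_gt0 m0 andbT eq_sym.
  by apply: contra Um; rewrite unitzE.
have [d [y [sqf ->]]] := IHk q lt_qk q0.
by exists d, (y * m); rewrite exprMn -mulrA.
Qed.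

(** With $h = \gcd(d, z)$, $d = d'h$ and $z = z'h$, the hypothesis gives $d' \mid z'^2 h$. Since
    $d'$ is coprime to $z'$, it divides $h$, so $d'^2 \mid d$ and $d'$ is a unit. *)
Lemma squarefree_dvdz_sqr (d z : int) :
  squarefree d -> (d %| z ^+ 2)%Z -> (d %| z)%Z.
Proof.
move=> sqf; have [-> _|z0] := eqVneq z 0; first exact: dvdz0.
set h := gcdz d z; have h0 : h != 0 by rewrite gcdz_eq0 negb_and z0 orbT.
have /dvdzP [d' Dd] : (h %| d)%Z by exact: dvdz_gcdl.
have /dvdzP [z' Dz] : (h %| z)%Z by exact: dvdz_gcdr.
have co : coprimez d' z'.
  have := mulz_gcdl d' z' h; rewrite -Dd -Dz -/h gez0_abs // => /eqP.
  by rewrite -{2}[h]mul1r (inj_eq (mulIf h0)).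
rewrite Dz Dd (_ : (z' * h) ^+ 2 = z' ^+ 2 * h * h); last by ring.
rewrite !dvdz_mul2r // Gauss_dvdzr ?coprimezXr // => d'h.
suff /sqf : (d' ^+ 2 %| d)%Z.
  by rewrite unitzE => /eqP d'1; rewrite dvdzE d'1 dvd1n.
by rewrite Dd expr2 dvdz_mul.
Qed.

Lemma resultant_polyC (R : comNzRingType) (p : {poly R}) (c : R) :
  resultant p c%:P = c ^+ (size p).-1.
Proof.
(* The truncated predecessor is 0 for [c = 0] too, so the Sylvester matrix has no rows coming from
   [p] and is scalar. *)
have n0 : (size (c%:P : {poly R})).-1 = 0%N by rewrite size_polyC; case: eqP.
rewrite /resultant; have -> : Sylvester_mx p c%:P = c%:M.
  apply/matrixP=> i j; rewrite Sylvester_mxE mxE.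
  case: (splitP i) => k Dk; first by case: k Dk => k /=; rewrite {1}n0.
  have Dki : i = k :> nat by rewrite Dk n0.
  rewrite coefC -(inj_eq val_inj) /= Dki subn_eq0.
  by case: ltngtP; rewrite ?mulr0n ?mulr1n ?mul0rn.
by rewrite det_scalar n0.
Qed.

(** Extends [resultant_in_ideal] to constant [q]: there the resultant is a power of [q] with
    exponent $\deg p \geq 1$, hence a multiple of [q]. This is needed because [g] may be
    constant. *)
Lemma resultant_ideal (R : comNzRingType) (p q : {poly R}) : (1 < size p)%N ->
  exists u v : {poly R}, (resultant p q)%:P = u * p + v * q.
Proof.
move=> p1; have [/size1_polyC -> | q1] := leqP (size q) 1.
  exists 0, (q`_0 ^+ (size p).-2)%:P.
  rewrite mul0r add0r resultant_polyC -polyCM -exprSr.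
  by case: (size p) p1 => [|[]].
by have [[u v] _ ->] := resultant_in_ideal p1 q1; exists u, v.
Qed.

Lemma meval_toZuv (p : {poly int}) (v : 'I_2 -> int) (s : int) :
  (toZuv p).[s%:MP].@[v] = p.[s].
Proof. by rewrite /toZuv horner_map /= mevalC. Qed.

Lemma dvdz_R00 (f g : {poly int}) (s d : int) : (1 < size f)%N ->
  (d %| f.[s])%Z -> (d %| g.[s])%Z -> (d %| R00 f g)%Z.
Proof.
move=> f1 df dg.
have sz1 : (1 < size ((uvar ^+ 2)%:P - toZuv f)%R)%N.
  have szf : size (- toZuv f) = size f.
    rewrite size_polyN size_map_poly_id0 // mpolyC_eq0 lead_coef_eq0.
    by rewrite -size_poly_gt0 ltnW.
  rewrite addrC size_polyDl szf // (leq_ltn_trans _ f1) //.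
  exact: size_polyC_leq1.
have [U [V E]] := resultant_ideal ((vvar ^+ 2)%:P - toZuv g) sz1.
(* At $x = s$, $u = v = 0$ the identity reads $N = -U f(s) - V g(s)$, with $U$, $V$ specialised
   too. *)
have := congr1 (fun P => P.[s%:MP].@[fun=> 0]) E.
rewrite /R00 /Ruv hornerC => ->.
rewrite !hornerE !(mevalD, mevalM, mevalN) /= !meval_toZuv !mevalXU.
by rewrite mul0r !sub0r !mulrN rpredD // rpredN dvdz_mull.
Qed.

Lemma horner_cubic (c2 c1 c0 s : int) :
  (cubic c2 c1 c0).[s] = s ^+ 3 + c2 * s ^+ 2 + c1 * s + c0.
Proof. by rewrite /cubic !hornerE. Qed.

Lemma size_cubic_gt1 (c2 c1 c0 : int) : (1 < size (cubic c2 c1 c0))%N.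
Proof.
rewrite ltnNge; apply/negP => /leq_sizeP /(_ 3 isT).
by rewrite /cubic !coefD !coefZ !coefXn coefX coefC /= !mulr0 !addr0.
Qed.

Theorem proposition3p4 (c2 c1 c0 : int) (g : {poly int}) :
  let f := cubic c2 c1 c0 in
  let N := R00 f g in
  discriminant f <> 0 ->
  no_common_root f g ->
  integer_points (f * g) =
    [set P : int * int |
       Mset N c2 c1 c0 P.1%:~R /\ P.2 ^+ 2 = f.[P.1] * g.[P.1]].
Proof.
move=> f N _ _; apply/seteqP; split=> -[s t] /=;
  rewrite /integer_points /= hornerM; last by case.
move=> tfg; split=> //.
have [fs0|fs0] := eqVneq f.[s] 0.
  exists s, 1; split; last by rewrite divr1.
    by split; [exact: squarefree1 | exact: dvd1z].
  exists 0; rewrite dvdz0; split=> //.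
  by move: fs0; rewrite horner_cubic !expr1n !mulr1 expr0n => ->.
have [d [y [sqf Df]]] := squarefree_part fs0.
have [d0 y0] : d != 0 /\ y != 0.
  by apply/andP; move: fs0; rewrite Df mulf_eq0 expf_eq0 negb_or.
(* Here $t^2 = d y^2 g(s)$, so $y^2 \mid t^2$. *)
have /dvdzP [z Dt] : (y %| t)%Z.
  rewrite -(@dvdz_pexp2r _ _ 2) // tfg Df -mulrA.
  by rewrite mulrCA dvdz_mulr.
have Dz : z ^+ 2 = d * g.[s].
  apply: (mulIf (_ : y ^+ 2 != 0)); first by rewrite expf_eq0.
  by rewrite -exprMn -Dt tfg Df mulrAC.
have /dvdzP [w Dw] : (d %| z)%Z.
  by apply: squarefree_dvdz_sqr; rewrite // Dz dvdz_mulr.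
have dg : (d %| g.[s])%Z.
  have -> : g.[s] = w ^+ 2 * d.
    by apply: (mulfI d0); rewrite -Dz Dw; ring.
  exact: dvdz_mull.
(* At $a = ds$ the homogenised cubic equals $d^3 f(s) = d^4 y^2$, the square of $b = d^2 y$. *)
exists (d * s), d; split.
- by split=> //; apply: (@dvdz_R00 _ _ s); rewrite ?size_cubic_gt1 // Df dvdz_mulr.
- exists (d ^+ 2 * y); split; first exact: dvdz_mulr.
  have -> : (d ^+ 2 * y) ^+ 2 = d ^+ 3 * (d * y ^+ 2) by ring.
  by rewrite -Df horner_cubic; ring.
- by rewrite intrM mulrAC mulfV ?mul1r // intr_eq0.
Qed.
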